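(* Let $\mathsf{G}$ be a geometric graph with $n$ vertices. Then $\psi_1(\mathsf{G})\le \left\lfloor \frac{n^2+n}{4}\right\rfloor$.
   Context: A geometric graph is a graph drawn in the plane with vertices at points in general position (no three collinear) and edges as straight-line segments. Two edges intersect if they share an endpoint or cross. An edge coloring with $k$ colors is a surjective map from the edge set onto $\{1,\dots,k\}$; it is complete if for every pair of distinct colors there is an edge of the first color and an edge of the second color that intersect. $\psi_1(\mathsf{G})$ (pseudoachromatic index) is the largest $k$ for which a complete edge coloring of $\mathsf{G}$ with $k$ colors exists. *)

(* Defs.v *)
From HB Require Import structures.
From mathcomp Require Import all_boot all_order all_algebra.
From mathcomp Require Import boolp classical_sets reals.

Set Implicit Arguments.
Unset Strict Implicit.
Unset Printing Implicit Defensive.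

Import Order.TTheory GRing.Theory Num.Theory.

Local Open Scope ring_scope.

Definition collinear3 (R : realType) (a b c : 'rV[R]_2) : Prop :=
  exists p d : 'rV[R]_2, d != 0 /\
    forall x, [\/ x = a, x = b | x = c] -> exists t : R, x = p + t *: d.

Definition open_segment (R : realType) (a b : 'rV[R]_2) : set 'rV[R]_2 :=
  [set x | exists t : R, 0 < t < 1 /\ x = (1 - t) *: a + t *: b].

(* [pos_inj] is not implied by [pos_general] when there are at most two
   vertices. *)
Record geometric_graph (R : realType) (V : finType) := GeometricGraph {
  pos : V -> 'rV[R]_2;
  edges : {set {set V}};
  pos_inj : injective pos;
  pos_general : forall u v w : V, u != v -> v != w -> u != w ->
    ~ collinear3 (pos u) (pos v) (pos w);
  edges_card2 : forall e : {set V}, e \in edges -> #|e| = 2%N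
}.

Section GeometricGraph.
Variables (R : realType) (V : finType) (G : geometric_graph R V).

Definition edge : finType := {e : {set V} | e \in edges G}.

Definition edge_interior (e : edge) : set 'rV[R]_2 :=
  [set x | exists u v : V,
     val e = [set u; v]%SET /\ open_segment (pos G u) (pos G v) x].

Definition share_endpoint (e f : edge) : Prop :=
  exists v : V, v \in val e /\ v \in val f.

(* Disjoint edges meet, if at all, in their relative interiors, since no
   vertex lies on an edge of which it is not an endpoint. *)
Definition cross (e f : edge) : Prop :=
  exists x : 'rV[R]_2, edge_interior e x /\ edge_interior f x.

Definition intersect (e f : edge) : Prop := share_endpoint e f \/ cross e f.

Definition edge_coloring (k : nat) (c : edge -> 'I_k) : Prop :=
  forall i : 'I_k, exists e : edge, c e = i.

Definition complete_coloring (k : nat) (c : edge -> 'I_k) : Prop :=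
  forall i j : 'I_k, i <> j ->
    exists e f : edge, [/\ c e = i, c f = j & intersect e f].

Definition has_complete_coloring (k : nat) : Prop :=
  exists c : edge -> 'I_k, edge_coloring c /\ complete_coloring c.

(* The range of [k] loses nothing, as colorings are surjective; see
   [psi1_max] and [psi1_attained]. *)
Definition psi1 : nat :=
  (\max_(k < #|edge|.+1 | `[< has_complete_coloring k >]) k)%N.

Lemma psi1_max (k : nat) : has_complete_coloring k -> (k <= psi1)%N.
Proof.
move=> hk; have [c [surj_c _]] := hk.
have lek : (k < #|edge|.+1)%N.
  rewrite ltnS -[k]card_ord -(@card_codom _ _ (fun i => sval (cid (surj_c i)))).
    exact: max_card.
  move=> i j eq_ij.
  by rewrite -(svalP (cid (surj_c i))) eq_ij (svalP (cid (surj_c j))).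
by apply: (@leq_bigmax_cond _ _ (fun k : 'I__ => k : nat) (Ordinal lek));
  apply/asboolP.
Qed.

Lemma has_complete_coloring_min :
  has_complete_coloring (0 < #|edge|)%N.
Proof.
case: posnP => [E0 | /card_gt0P[e0 _]].
  have noE (e : edge) : False by have := card0_eq E0 e; rewrite inE.
  exists (fun e => False_rect _ (noE e)).
  by split=> [[]|[]].
exists (fun=> ord0); split=> [i|i j].
  by exists e0; rewrite (ord1 i).
by rewrite (ord1 i) (ord1 j) => /(_ erefl).
Qed.

Lemma psi1_attained : has_complete_coloring psi1.
Proof.
have lt0 : ((0 < #|edge|)%N < #|edge|.+1)%N by case: #|edge|.
have P0 : `[< has_complete_coloring (Ordinal lt0) >].
  by apply/asboolP; exact: has_complete_coloring_min.
have [|i /asboolP ? psi1E] := @eq_bigmax_cond _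
    (fun k : 'I_#|edge|.+1 => `[< has_complete_coloring k >])
    (fun k => k : nat).
  by apply/card_gt0P; exists (Ordinal lt0).
by rewrite /psi1 psi1E.
Qed.

End GeometricGraph.

(* Main.v *)
Require Import Defs.
From mathcomp Require Import all_boot all_order all_algebra.
From mathcomp Require Import boolp classical_sets reals.
From mathcomp Require Import ring zify.

(** In a complete coloring with [k] colors of [m] edges, at least [2 k - m]
    colors are used exactly once, and the edges bearing them pairwise
    intersect.  By the theorem of Hopf, Pannwitz and Erdős, [n] points in
    general position span at most [n] pairwise intersecting segments, so
    [2 k <= m + n <= n (n - 1) / 2 + n].

    The bound on pairwise intersecting segments is Perles' charging argument:
    each edge [ab] is charged to an endpoint from which no other edge leaves to
    its left.  Such an endpoint exists: an edge [ac] to the left of [ab] and an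
    edge [bd] to the left of [ba] are on opposite sides of the line [ab], hence
    do not meet.  A vertex is charged at most once, since of two edges leaving
    it one is to the left of the other. *)

Set Implicit Arguments.
Unset Strict Implicit.
Unset Printing Implicit Defensive.

Import Order.TTheory GRing.Theory Num.Theory.

Local Open Scope ring_scope.

Section Orientation.
Variable R : realType.
Implicit Types a b c d x : 'rV[R]_2.

(** Twice the signed area of the triangle [a b c]: positive when [c] lies to the left of the line
    directed from [a] to [b]. *)
Definition orient a b c : R :=
  (b 0 0 - a 0 0) * (c 0 1 - a 0 1) - (b 0 1 - a 0 1) * (c 0 0 - a 0 0).

Lemma orient_swap12 a b c : orient b a c = - orient a b c.
Proof. by rewrite /orient; ring. Qed.

Lemma orient_swap23 a b c : orient a c b = - orient a b c.
Proof. by rewrite /orient; ring. Qed.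

Lemma orient_id13 a b : orient a b a = 0.
Proof. by rewrite /orient; ring. Qed.

Lemma orient_id23 a b : orient a b b = 0.
Proof. by rewrite /orient; ring. Qed.

(** The affine function [orient a b] vanishes at [a] and at [b], so along a line through either
    point it is proportional to the parameter. *)
Lemma orient_combl a b c t :
  orient a b ((1 - t) *: a + t *: c) = t * orient a b c.
Proof. by rewrite /orient !mxE; ring. Qed.

Lemma orient_combr a b c t :
  orient a b ((1 - t) *: b + t *: c) = t * orient a b c.
Proof. by rewrite /orient !mxE; ring. Qed.

Lemma row2P a b : a 0 0 = b 0 0 -> a 0 1 = b 0 1 -> a = b.
Proof.
move=> e0 e1; apply/rowP => i.
case: (unliftP 0 i) => [j|] ->; last by [].
by rewrite ord1 (_ : lift 0 0 = 1) //; apply/val_inj.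
Qed.

Lemma orient0_collinear a b c : a != b -> orient a b c = 0 -> collinear3 a b c.
Proof.
move=> ab; rewrite /orient => o0; exists a, (b - a); split.
  by rewrite subr_eq0 eq_sym.
set u := b 0 0 - a 0 0 in o0; set v := b 0 1 - a 0 1 in o0.
have q0 : u ^+ 2 + v ^+ 2 != 0.
  apply: contra ab; rewrite paddr_eq0 ?sqr_ge0 // !sqrf_eq0 !subr_eq0.
  by case/andP => /eqP e0 /eqP e1; apply/eqP; apply: row2P.
move=> x [] ->.
- by exists 0; rewrite scale0r addr0.
- by exists 1; rewrite scale1r addrC subrK.
(* The parameter of the orthogonal projection of [c] onto the line through [a] and [b]; by [o0], [c]
   is its own projection. *)
exists (((c 0 0 - a 0 0) * u + (c 0 1 - a 0 1) * v) / (u ^+ 2 + v ^+ 2)).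
move: o0; set p := c 0 0 - a 0 0; set q := c 0 1 - a 0 1 => o0.
apply: row2P; rewrite !mxE -/u -/v; apply/eqP; rewrite addrC -subr_eq -/p -/q;
  apply/eqP; rewrite mulrAC; apply: (canRL (mulfK q0)).
- have -> : p * (u ^+ 2 + v ^+ 2) =
    (p * u + q * v) * u - (u * q - v * p) * v by ring.
  by rewrite o0 mul0r subr0.
- have -> : q * (u ^+ 2 + v ^+ 2) =
    (p * u + q * v) * v + (u * q - v * p) * u by ring.
  by rewrite o0 mul0r addr0.
Qed.

End Orientation.

Section PairwiseIntersecting.
Variables (R : realType) (V : finType) (G : geometric_graph R V).
Implicit Types (e f : edge G) (u v w : V).

Local Notation orientV u v w := (orient (pos G u) (pos G v) (pos G w)).

Lemma orientV_neq0 u v w : u != v -> v != w -> u != w -> orientV u v w != 0.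
Proof.
move=> uv vw uw; apply/eqP => o0.
apply: (pos_general (g := G) uv vw uw); apply: orient0_collinear => //.
by rewrite (inj_eq (@pos_inj _ _ G)).
Qed.

Lemma edgeP e : exists u v, u != v /\ val e = [set u; v]%SET.
Proof.
exact/cards2P/eqP/(edges_card2 (valP e)).
Qed.

Lemma edge_ends e u v : val e = [set u; v]%SET -> u != v.
Proof.
move=> E; have := edges_card2 (valP e).
by rewrite E cards2; case: eqP.
Qed.

Lemma set2_inj u v w : [set u; v]%SET = [set u; w]%SET -> v = w.
Proof.
move=> E; have : v \in [set u; w]%SET by rewrite -E set22.
rewrite !inE => /orP[/eqP vu|/eqP //].
have : w \in [set u; v]%SET by rewrite E set22.
by rewrite vu !inE orbb => /eqP.
Qed.

Lemma set2_eq u v u' v' : [set u; v]%SET = [set u'; v']%SET ->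
  (u = u' /\ v = v') \/ (u = v' /\ v = u').
Proof.
move=> E; have : u \in [set u'; v']%SET by rewrite -E set21.
rewrite !inE => /orP[] /eqP uE; subst u.
- by left; split=> //; apply: set2_inj E.
- right; split=> //; apply: (@set2_inj v').
  by rewrite E finset.setUC.
Qed.

Lemma edge_interiorP e u v x : val e = [set u; v]%SET -> edge_interior e x ->
  exists2 t : R, 0 < t & x = (1 - t) *: pos G u + t *: pos G v.
Proof.
move=> E [u' [v' [E' [t [/andP[t0 t1] ->]]]]]; rewrite E in E'.
case: (set2_eq E') => -[-> ->]; first by exists t.
by exists (1 - t); rewrite ?subr_gt0 // subKr addrC.
Qed.

Lemma opposite_sides_disjoint u v w z e f :
  val e = [set u; w]%SET -> val f = [set v; z]%SET -> u != v ->
  0 < orientV u v w -> 0 < orientV v u z -> ~ intersect e f.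
Proof.
move=> Ee Ef uv ow; rewrite orient_swap12 oppr_gt0 => oz [].
  case=> x []; rewrite Ee Ef !inE => /orP[] /eqP -> /orP[] /eqP E.
  - by rewrite E eqxx in uv.
  - by move: oz; rewrite -E orient_id13 ltxx.
  - by move: ow; rewrite E orient_id23 ltxx.
  - by move: oz; rewrite -E => /(lt_trans ow); rewrite ltxx.
case=> x [] /(edge_interiorP Ee)[t t0 ->] /(edge_interiorP Ef)[s s0].
(* A common interior point would be strictly left of the line from [u] to [v], being on [e], and
   strictly right of it, being on [f]. *)
move/(congr1 (orient (pos G u) (pos G v))).
rewrite orient_combl orient_combr => E.
have := mulr_gt0 t0 ow; rewrite E pmulr_rgt0 // => /(lt_trans oz).
by rewrite ltxx.
Qed.

Lemma card_pairwise_intersecting (S : {set edge G}) :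
  {in S &, forall e f, e <> f -> intersect e f} -> (#|S| <= #|V|)%N.
Proof.
move=> meetS.
(* The condition under which the edge joining [u] and [v] may be charged to [u]. *)
pose leads u v :=
  forall w e, e \in S -> val e = [set u; w]%SET -> ~ 0 < orientV u v w.
have leadsVex u v e : e \in S -> val e = [set u; v]%SET ->
    leads u v \/ leads v u.
  move=> eS E; have uv := edge_ends E.
  case: (pselect (leads u v)) => [|nuv]; [by left | right].
  move=> z f fS Ef oz; apply: nuv => w g gS Eg ow.
  (* Here [g] and [f] are distinct: otherwise [u = v], or [w = v] and [ow] fails. *)
  apply: (opposite_sides_disjoint Eg Ef uv ow oz); apply: meetS => // gf.
  move: Ef; rewrite -gf Eg => /set2_eq[] [E1 E2].
    by rewrite E1 eqxx in uv.
  by move: ow; rewrite E2 orient_id23 ltxx.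
have /choice[h hP] : forall e, exists u, e \in S ->
    exists2 v, val e = [set u; v]%SET & leads u v.
  move=> e; have [u [v [_ E]]] := edgeP e.
  case: (boolP (e \in S)) => [eS|_]; last by exists u.
  have [l|l] := leadsVex u v e eS E; first by exists u => _; exists v.
  by exists v => _; exists u; rewrite // finset.setUC.
apply: (@leq_card_in _ _ h S) => e f eS fS hef.
have [v Ee lv] := hP _ eS; have [w Ef lw] := hP _ fS.
rewrite -hef in Ef lw.
apply: val_inj; rewrite /= Ee Ef; congr [set _; _]%SET.
apply/eqP/negPn/negP => vw.
(* One of the two edges leaves [h e] to the left of the other, against [lw] or [lv]. *)
have /lt_total/orP[] := orientV_neq0 (edge_ends Ee) vw (edge_ends Ef).
- by rewrite -oppr_gt0 -orient_swap23; apply: lw eS Ee.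
- exact: lv fS Ef.
Qed.

Lemma card_edge : (#|edge G| <= 'C(#|V|, 2))%N.
Proof.
rewrite card_sig -card_draws; apply: subset_leq_card; apply/fintype.subsetP => e.
by rewrite !inE => /edges_card2 ->.
Qed.

End PairwiseIntersecting.

Section UniqueColors.
Variables (T : finType) (k : nat) (c : T -> 'I_k).

Definition sole_colored : {set T} :=
  [set x | [forall y, (c y == c x) ==> (y == x)]].

Lemma sole_coloredP x y : x \in sole_colored -> c y = c x -> y = x.
Proof. by rewrite inE => /forallP/(_ y)/implyP h /eqP/h/eqP. Qed.

(** Each color contributes at least 2 to the right-hand side: either its class has two elements, or
    its only element is counted in both terms. *)
Lemma card_sole_colored : (forall i, exists x, c x = i) ->
  (2 * k <= #|T| + #|sole_colored|)%N.
Proof.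
move=> surj_c.
rewrite -!sum1_card (partition_big c xpredT) //= (partition_big c xpredT) //=.
rewrite -big_split /= mulnC -{1}[k]card_ord -sum_nat_const.
apply: leq_sum => i _; have [x <-] := surj_c i.
rewrite (bigD1 x) //=.
have [[y /andP[cy yx]]|noy] := pselect (exists y, (c y == c x) && (y != x)).
  by rewrite (bigD1 y) ?cy ?inE //= addnA -addnA.
have xS : x \in sole_colored.
  rewrite inE; apply/forallP => y; apply/implyP => cy.
  by apply/negPn/negP => yx; apply: noy; exists y; rewrite cy.
by rewrite [X in (_ <= _ + X)%N](bigD1 x) ?xS ?eqxx //= addnACA leq_addr.
Qed.

End UniqueColors.

Theorem theorem4 (R : realType) (V : finType) (G : geometric_graph R V)
    (n : nat) (hn : #|V| = n) :
  (psi1 G <= (n ^ 2 + n) %/ 4)%N.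
Proof.
have [c [surj_c complete_c]] := psi1_attained G.
have leS : (#|sole_colored c| <= n)%N.
  rewrite -hn; apply: card_pairwise_intersecting => e f eS fS ef.
  have cef : c e <> c f by move/(sole_coloredP fS).
  (* The intersecting edges that completeness provides for these two colors can only be [e] and [f]
     themselves. *)
  have [e' [f' [ce cf]]] := complete_c _ _ cef.
  by rewrite (sole_coloredP eS ce) (sole_coloredP fS cf).
have := card_sole_colored surj_c; have := card_edge G.
(* This gives [2 * 'C(n, 2) = n * n.-1], so that the bounds add up to [4 k <= n (n - 1) + 2 n]; the
   case on [n] removes the predecessor. *)
have := mul_bin_diag n 1.
rewrite hn bin1 leq_divRL // -mulnn; case: n {hn} leS => [|n] /=; nia.
Qed.
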